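(* Let $n \ge 1$ be an integer. Every play of the ordered Zeckendorf game on $n$ terminates after finitely many moves. Moreover, the final state of every play is the Zeckendorf decomposition of $n$, expressed as a strictly increasing sequence of Fibonacci numbers; that is, it is the tuple $(F_{i_1}, \dots, F_{i_k})$ with $i_1 < i_2 < \dots < i_k$, $i_{j+1} \ge i_j + 2$ for all $1 \le j < k$, and $F_{i_1} + \dots + F_{i_k} = n$.
   Context: The Fibonacci numbers are indexed by $F_1 = 1$, $F_2 = 2$, and $F_{i+1} = F_i + F_{i-1}$ for $i \ge 2$. The Zeckendorf decomposition of a positive integer $n$ is its unique representation as a sum of distinct, pairwise non-consecutive Fibonacci numbers $F_i$, $i \ge 1$ (non-consecutive means no two indices differ by 1). The (two-player) ordered Zeckendorf game on $n$: a state is a finite ordered list (tuple) of Fibonacci numbers. The initial state is the list $(F_1, F_1, \dots, F_1)$ of $n$ copies of $F_1$. Players alternate turns; on each turn the player performs one of the following legal moves on two adjacent entries of the list (the other entries and their order being unchanged): (1) Merging: replace an adjacent pair $(F_i, F_{i+1})$ with the single entry $F_{i+2}$. (2) Merging ones: replace an adjacent pair $(F_1, F_1)$ with the single entry $F_2$. (3) Splitting: replace an adjacent pair $(F_i, F_i)$ with $(F_{i-2}, F_{i+1})$, for $i > 2$. (4) Splitting twos: replace an adjacent pair $(F_2, F_2)$ with $(F_1, F_3)$. (5) Switching: replace an adjacent pair $(F_i, F_j)$ with $(F_j, F_i)$ whenever $i > j$. The game ends when no legal move can be applied. *)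

(* Defs.v *)
From mathcomp Require Import all_boot.
Set Implicit Arguments.
Unset Strict Implicit.
Unset Printing Implicit Defensive.

(* F_1 = 1, F_2 = 2: the value at 0 is a junk one, chosen so that the recurrence
   yields F_2 = 2; every index occurring in the game is at least 1. *)
Fixpoint F (n : nat) : nat :=
  match n with
  | 0 => 1
  | 1 => 1
  | (m.+1 as k).+1 => F k + F m
  end.

(* A state is the list of the values F_i, not of their indices; [rewrites x y]
   says that the adjacent pair of entries x may be replaced with y. *)
Inductive rewrites : seq nat -> seq nat -> Prop :=
| Merge i of 0 < i : rewrites [:: F i; F i.+1] [:: F i.+2]
| MergeOnes : rewrites [:: F 1; F 1] [:: F 2]
| Split i of 2 < i : rewrites [:: F i; F i] [:: F (i - 2); F i.+1]
| SplitTwos : rewrites [:: F 2; F 2] [:: F 1; F 3]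
| Switch i j of 0 < j & j < i : rewrites [:: F i; F j] [:: F j; F i].

Definition move (s t : seq nat) : Prop :=
  exists a b x y : seq nat,
    [/\ rewrites x y, s = a ++ x ++ b & t = a ++ y ++ b].

Definition initial (n : nat) : seq nat := nseq n (F 1).

Definition terminal (s : seq nat) : Prop := forall t, ~ move s t.

(* p k is the state after k moves; which player moves is the parity of k. *)
Definition infinite_play (n : nat) (p : nat -> seq nat) : Prop :=
  p 0 = initial n /\ forall k, move (p k) (p k.+1).

(* Only the values p 0, ..., p m are relevant. *)
Definition complete_play (n m : nat) (p : nat -> seq nat) : Prop :=
  [/\ p 0 = initial n,
      forall k, k < m -> move (p k) (p k.+1)
    & terminal (p m)].

(* The gap condition subsumes strict monotonicity of the indices. *)
Definition increasing_zeckendorf (n : nat) (s : seq nat) : Prop :=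
  exists idx : seq nat,
    [/\ s = map F idx,
        all (fun i => 0 < i) idx,
        sorted ltn idx,
        sorted (fun i j => i + 2 <= j) idx
      & \sum_(i <- idx) F i = n].

(* Main.v *)
Require Import Defs.
From mathcomp Require Import all_boot zify.
Set Implicit Arguments.
Unset Strict Implicit.
Unset Printing Implicit Defensive.

(** Every move replaces an adjacent pair [x, y] with a pair of the same sum and
    a smaller first entry, or with the single entry [x + y].  Look at the
    partial sums of the list, taken from the left.  In the first case exactly
    one of them changes, the one that ends at [x], and it decreases; in the
    second case this positive partial sum disappears and the others remain.
    The sum of all partial sums therefore drops at every move
    ([move_potential]), which excludes infinite plays.

    Moves preserve the total, and they keep all entries Fibonacci numbers of
    positive index.  On two such adjacent entries [F i], [F j] some move is
    available as soon as [j < i + 2] ([rewritable_pair]): a switch if [j < i], a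
    splitting or the merging of ones if [i = j], a merging if [j = i + 1].  So in
    a terminal state each index exceeds the preceding one by at least two
    ([terminal_gaps]), and such a state is a Zeckendorf decomposition of its
    total. *)

Lemma F_gt0 i : 0 < F i.
Proof.
suff: 0 < F i /\ 0 < F i.+1 by case.
by elim: i => [//|i [Fi_gt0 Fi1_gt0]]; split=> //=; rewrite addn_gt0 Fi1_gt0.
Qed.

Lemma F_rec i : F i.+2 = F i.+1 + F i.
Proof. by []. Qed.

Lemma F_ltS i : 0 < i -> F i < F i.+1.
Proof. by case: i => // i _; rewrite F_rec; have := F_gt0 i; lia. Qed.

Lemma F_lt i j : 0 < j -> j < i -> F j < F i.
Proof.
move=> j_gt0; elim: i => // i IHi; rewrite ltnS leq_eqVlt.
case/predU1P=> [<-|lt_ji]; first exact: F_ltS.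
by rewrite (ltn_trans (IHi lt_ji)) // F_ltS // (ltn_trans j_gt0).
Qed.

(** Termination and the invariance of the total depend on the five kinds of moves
    only through this dichotomy.  The equality of sums comes from the Fibonacci
    recurrence, used twice for a splitting: [2 F_i = F_(i-2) + F_(i+1)]. *)
Lemma rewrites_shape x y : rewrites x y ->
  exists u v, 0 < u /\ x = [:: u; v] /\
    (y = [:: u + v] \/
     exists u' v', [/\ y = [:: u'; v'], u' < u & u' + v' = u + v]).
Proof.
case=> [i i_gt0| |i i_gt2| |i j j_gt0 lt_ji].
- exists (F i), (F i.+1); split; first exact: F_gt0.
  by split=> //; left; rewrite F_rec addnC.
- by exists 1, 1; do 2!split=> //; left.
- exists (F i), (F i); split; first exact: F_gt0.
  split=> //; right; exists (F (i - 2)), (F i.+1).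
  split=> //; first by apply: F_lt; lia.
  case: i i_gt2 => [|[|i]] // _; rewrite !subSS subn0 !F_rec; lia.
- by exists 2, 2; do 2!split=> //; right; exists 1, 3.
- exists (F i), (F j); split; first exact: F_gt0.
  split=> //; right; exists (F j), (F i).
  by split=> //; [exact: F_lt | rewrite addnC].
Qed.

(** Partial sums are preferred to the equivalent weighting of each entry by the
    number of entries from it onwards, because a move leaves all but one of them
    in place. *)
Definition potential (s : seq nat) : nat := sumn (scanl addn 0 s).

Lemma move_potential s t : move s t -> potential t < potential s.
Proof.
case=> a [b [x [y [/rewrites_shape[u [v [u_gt0 [-> y_cases]]]] -> ->]]]].
rewrite /potential !scanl_cat !sumn_cat ltn_add2l.
(* [c] is the partial sum just before the pair, so that [c + u] is the partial
   sum that disappears or decreases. *)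
set c := foldl addn 0 a.
case: y_cases => [->|[u' [v' [-> lt_u sum_uv]]]] /=.
  by rewrite addnA; lia.
by rewrite -!addnA sum_uv; lia.
Qed.

Lemma no_infinite_descent (p : nat -> seq nat) :
  ~ (forall k, move (p k) (p k.+1)).
Proof.
move=> pM; have bound k : potential (p k) + k <= potential (p 0).
  elim: k => [|k IHk]; first by rewrite addn0.
  by have := move_potential (pM k); lia.
by have := bound (potential (p 0)).+1; lia.
Qed.

Lemma move_sumn s t : move s t -> sumn t = sumn s.
Proof.
case=> a [b [x [y [/rewrites_shape[u [v [_ [-> y_cases]]]] -> ->]]]].
rewrite !sumn_cat; congr (_ + (_ + _)).
case: y_cases => [->|[u' [v' [-> _ sum_uv]]]] /=; lia.
Qed.

Definition fib_entries (s : seq nat) : Prop :=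
  exists2 idx, s = map F idx & all (fun i => 0 < i) idx.

Lemma fib_entries_cat s t :
  fib_entries (s ++ t) <-> fib_entries s /\ fib_entries t.
Proof.
split=> [[idx st_idx idx_gt0]|[[l -> l_gt0] [r -> r_gt0]]]; last first.
  by exists (l ++ r); rewrite ?map_cat ?all_cat ?l_gt0.
move: idx_gt0; rewrite -(cat_take_drop (size s) idx) all_cat => /andP[gt0l gt0r].
split; [exists (take (size s) idx) | exists (drop (size s) idx)] => //.
  by rewrite map_take -st_idx take_size_cat.
by rewrite map_drop -st_idx drop_size_cat.
Qed.

Lemma rewrites_fib_entries x y : rewrites x y -> fib_entries y.
Proof.
case=> [i i_gt0| |i i_gt2| |i j j_gt0 lt_ji].
- by exists [:: i.+2].
- by exists [:: 2].
- by exists [:: i - 2; i.+1] => //=; lia.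
- by exists [:: 1; 3].
- by exists [:: j; i] => //=; lia.
Qed.

Lemma move_fib_entries s t : move s t -> fib_entries s -> fib_entries t.
Proof.
case=> a [b [x [y [xy -> ->]]]].
rewrite !fib_entries_cat => -[a_fib [_ b_fib]].
by do 2!split=> //; apply: rewrites_fib_entries xy.
Qed.

Lemma rewritable_pair i j : 0 < i -> 0 < j -> j < i + 2 ->
  exists y, rewrites [:: F i; F j] y.
Proof.
move=> i_gt0 j_gt0 lt_ji2; case: (ltngtP j i) => [lt_ji|lt_ij|eq_ji].
- by exists [:: F j; F i]; apply: Switch.
- have -> : j = i.+1 by lia.
  by exists [:: F i.+2]; apply: Merge.
rewrite {}eq_ji; case: i i_gt0 {lt_ji2} => [|[|[|i]]] // _.
- by exists [:: F 2]; apply: MergeOnes.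
- by exists [:: F 1; F 3]; apply: SplitTwos.
- by exists [:: F (i.+3 - 2); F i.+4]; apply: Defs.Split.
Qed.

(** A move on the tail is a move on the whole list. *)
Lemma terminal_behead x s : terminal (x :: s) -> terminal s.
Proof.
move=> xs_term t [a [b [y [z [yz s_eq _]]]]].
by apply: (xs_term (x :: a ++ z ++ b)); exists (x :: a), b, y, z; rewrite s_eq.
Qed.

Lemma terminal_gaps idx : all (fun i => 0 < i) idx -> terminal (map F idx) ->
  sorted (fun i j => i + 2 <= j) idx.
Proof.
elim: idx => [//|i [//|j idx] IHidx] /andP[i_gt0 idx_gt0] idx_term.
have /andP[j_gt0 _] := idx_gt0.
apply/andP; split; last exact: IHidx idx_gt0 (terminal_behead idx_term).
rewrite leqNgt; apply/negP=> /(rewritable_pair i_gt0 j_gt0)[y ij_y].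
by apply: (idx_term (y ++ map F idx)); exists [::], (map F idx), [:: F i; F j], y.
Qed.

Lemma terminal_zeckendorf s : fib_entries s -> terminal s ->
  increasing_zeckendorf (sumn s) s.
Proof.
case=> idx -> idx_gt0 /(terminal_gaps idx_gt0) gaps; exists idx; split=> //.
  by apply: sub_sorted gaps => i j; lia.
by rewrite sumnE big_map.
Qed.

Lemma play_invariants n m (p : nat -> seq nat) :
  p 0 = initial n -> (forall k, k < m -> move (p k) (p k.+1)) ->
  fib_entries (p m) /\ sumn (p m) = n.
Proof.
move=> p0; elim: m => [_|m IHm pM].
  rewrite p0 /initial sumn_nseq mul1n; split=> //.
  by exists (nseq n 1); rewrite ?map_nseq // all_nseq orbT.
have [|m_fib m_sum] := IHm; first by move=> k /ltnW; apply: pM.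
have mM := pM m (ltnSn m).
by split; [exact: move_fib_entries mM m_fib | rewrite (move_sumn mM)].
Qed.

Theorem theorem1p3 (n : nat) (hn : 1 <= n) :
  (forall p : nat -> seq nat, ~ infinite_play n p) /\
  (forall (m : nat) (p : nat -> seq nat),
     complete_play n m p -> increasing_zeckendorf n (p m)).
Proof.
split=> [p [_ /no_infinite_descent] //|m p [p0 pM m_term]].
have [m_fib m_sum] := play_invariants p0 pM.
by rewrite -m_sum; apply: terminal_zeckendorf.
Qed.
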